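(* Let $f,g:(0,\infty)\to\mathbb{R}$ be convex functions with $f(1)=g(1)=0$. Then every $(f,g)$-achievable point is a convex combination of two $(f,g)$-achievable points that are $2$-achievable. Consequently, every $(f,g)$-achievable point is $4$-achievable.
   Context: For a convex function $f:(0,\infty)\to\mathbb{R}$ with $f(1)=0$, set $f(0)=\lim_{t\to0}f(t)$, $f^{\ast}(t)=tf(t^{-1})$ and $f^{\ast}(0)=\lim_{t\to\infty}f(t)/t$. If $P,Q$ are probability measures absolutely continuous with respect to a measure $\mu$ with densities $p=dP/d\mu$, $q=dQ/d\mu$, the $f$-divergence is $D_f(P,Q)=\int_{\{q>0\}} f(p/q)\,dQ+f^{\ast}(0)\,P(q=0)$. A point $(x,y)\in\mathbb{R}^2$ is $(f,g)$-achievable if there exist probability measures $P,Q$ on some common measurable space ($\sigma$-algebra) with $(x,y)=(D_f(P,Q),D_g(P,Q))$. A point $(x,y)$ is $d$-achievable if there exist probability vectors $P,Q\in\mathbb{R}^d$ (distributions on a $d$-element set) with $(x,y)=(D_f(P,Q),D_g(P,Q))$. *)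

(* Defs.v *)
From HB Require Import structures.
From mathcomp Require Import all_boot all_order all_algebra.
From mathcomp Require Import all_classical all_reals all_analysis.
Set Implicit Arguments. Unset Strict Implicit. Unset Printing Implicit Defensive.
Import Order.TTheory GRing.Theory Num.Theory.
Import numFieldNormedType.Exports.
Local Open Scope classical_set_scope.
Local Open Scope ring_scope.

Definition convex_pos {R : realType} (f : R -> R) : Prop :=
  forall (x y t : R), 0 < x -> 0 < y -> 0 <= t <= 1 ->
    f (t * x + (1 - t) * y) <= t * f x + (1 - t) * f y.

Definition fzero {R : realType} (f : R -> R) : \bar R :=
  lim ((f t)%:E @[t --> 0^'+]).

Definition fstar0 {R : realType} (f : R -> R) : \bar R :=
  lim ((f t / t)%:E @[t --> +oo]).

Definition fext {R : realType} (f : R -> R) (t : R) : \bar R :=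
  if t == 0 then fzero f else (f t)%:E.

(* D_f(P,Q) where p = dP/dmu, q = dQ/dmu:
   int_{q>0} f(p/q) dQ + f^*(0) P(q = 0), with dQ = q dmu, P(q=0) = int_{q=0} p dmu *)
Definition fdiv {R : realType} (f : R -> R) {d} {T : measurableType d}
    (mu : {measure set T -> \bar R}) (p q : T -> R) : \bar R :=
  ((\int[mu]_(x in [set x | (0 < q x)%R]) (fext f (p x / q x) * (q x)%:E))
   + fstar0 f * (\int[mu]_(x in [set x | (q x = 0)%R]) (p x)%:E))%E.

Definition prob_density {R : realType} {d} {T : measurableType d}
    (mu : {measure set T -> \bar R}) (p : T -> R) : Prop :=
  measurable_fun setT p /\ (forall x, 0 <= p x) /\
  (\int[mu]_x (p x)%:E = 1)%E.

(* (x,y) is (f,g)-achievable: there are probability measures P, Q on a common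
   measurable space (given by densities p, q w.r.t. a common measure mu)
   with (x, y) = (D_f(P,Q), D_g(P,Q)). *)
Definition achievable {R : realType} (f g : R -> R) (x y : R) : Prop :=
  exists (d : measure_display) (T : measurableType d)
         (mu : {measure set T -> \bar R}) (p q : T -> R),
    prob_density mu p /\ prob_density mu q /\
    fdiv f mu p q = x%:E /\ fdiv g mu p q = y%:E.

Definition prob_vec {R : realType} (n : nat) (p : 'I_n -> R) : Prop :=
  (forall i, 0 <= p i) /\ \sum_(i < n) p i = 1.

(* D_f for distributions on the n-element set 'I_n (mu = counting measure) *)
Definition fdiv_fin {R : realType} (f : R -> R) (n : nat) (p q : 'I_n -> R)
  : \bar R :=
  ((\sum_(i < n | (0 < q i)%R) (fext f (p i / q i) * (q i)%:E))
   + fstar0 f * (\sum_(i < n | (q i == 0)%R) p i)%:E)%E.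

Definition achievable_fin {R : realType} (f g : R -> R) (n : nat) (x y : R)
  : Prop :=
  exists p q : 'I_n -> R, prob_vec p /\ prob_vec q /\
    fdiv_fin f p q = x%:E /\ fdiv_fin g p q = y%:E.

(* Main.v *)
(* An f-divergence is the integral of the perspective (p, q) |-> q f(p/q). Two
   sample points s, t with p s > q s and p t < q t carry a two-point pair of
   distributions, hence a 2-achievable point. Slope separation, first of sample
   points and then of such pairs, puts (x, y) in a triangle whose vertices are the
   origin, which is 2-achievable by P = Q, and two 2-achievable points.
   Replacing P by (1 - s) Q + s P joins every 2-achievable point to the origin by
   a path of 2-achievable points, and the intermediate value theorem along such a
   path reduces the triangle to a segment. Mixing the two end points on disjoint
   two-element sets gives 4-achievability. *)
Require Import Defs.
From HB Require Import structures.
From mathcomp Require Import all_boot all_order all_algebra.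
From mathcomp Require Import all_classical all_reals all_analysis.
From mathcomp Require Import measurable_realfun.
From mathcomp Require Import ring lra.
Import Order.TTheory GRing.Theory Num.Theory.
Import numFieldNormedType.Exports.
Set Implicit Arguments.
Unset Strict Implicit.
Local Open Scope classical_set_scope.
Local Open Scope ring_scope.

(** * Convex functions on the positive half-line: continuity and behaviour at 0 *)

(** [x + s * d] lies between [x] and [x + d], which bounds [f] there from above; [x] lies between
    [x - d] and [x + s * d], which bounds it from below. *)
Lemma convex_pos_dist {R : realType} (f : R -> R) (x d s : R) :
  convex_pos f -> `|d| < x -> 0 <= s <= 1 ->
  `|f (x + s * d) - f x| <= s * (`|f (x + d) - f x| + `|f (x - d) - f x|).
Proof.
move=> fc; rewrite ltr_norml => /andP[dx xd] /andP[s0 s1].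
have x0 : 0 < x by lra.
have h1 : f (x + s * d) <= s * f (x + d) + (1 - s) * f x.
  have -> : x + s * d = s * (x + d) + (1 - s) * x by ring.
  by apply: fc; lra.
have h2 : (1 + s) * f x <= f (x + s * d) + s * f (x - d).
  have p0 : 0 < 1 + s by lra.
  have q0 : 0 < x + s * d by nra.
  have := fc (x + s * d) (x - d) (1 + s)^-1 q0 ltac:(lra).
  have -> : (1 + s)^-1 * (x + s * d) + (1 - (1 + s)^-1) * (x - d) = x.
    by field; lra.
  have -> : (1 + s)^-1 * f (x + s * d) + (1 - (1 + s)^-1) * f (x - d)
     = (f (x + s * d) + s * f (x - d)) / (1 + s) by field; lra.
  rewrite ler_pdivlMr// mulrC; apply.
  by rewrite invr_ge0 invf_le1//; lra.
have := ler_norm (f (x + d) - f x); have := ler_norm (f (x - d) - f x).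
have := normr_ge0 (f (x + d) - f x); have := normr_ge0 (f (x - d) - f x).
by rewrite ler_norml; move=> *; apply/andP; split; nra.
Qed.

Lemma convex_pos_continuous {R : realType} (f : R -> R) (x : R) :
  convex_pos f -> 0 < x -> {for x, continuous f}.
Proof.
move=> fc x0.
(* [M] dominates the increments of [f] over [x / 2] in both directions; the added 1 makes it a
   legitimate divisor. *)
set M : R := `|f (x + x / 2) - f x| + `|f (x - x / 2) - f x| + 1.
have M0 : 0 < M.
  by rewrite /M ltr_wpDl.
apply/cvgrPdist_le => e e0.
exists (Num.min (x / 2) (e * (x / 2) / M)) => /=.
  by rewrite lt_min !divr_gt0// mulr_gt0// divr_gt0.
move=> y /=; rewrite lt_min => /andP[].
set r := `|x - y| => r1 r2.
have r0 : 0 <= r by rewrite normr_ge0.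
have hs : 0 <= r / (x / 2) <= 1.
  by rewrite divr_ge0 ?ler_pdivrMr//=; lra.
have H : forall d, `|d| = x / 2 -> y = x + r / (x / 2) * d -> M =
    `|f (x + d) - f x| + `|f (x - d) - f x| + 1 -> `|f x - f y| <= e.
  move=> d dx ye Me.
  have := @convex_pos_dist _ f x d _ fc ltac:(rewrite dx; lra) hs.
  rewrite -ye distrC => h; apply: (le_trans h).
  apply: (@le_trans _ _ (r / (x / 2) * M)).
    by rewrite ler_wpM2l; [|lra|rewrite Me; lra].
  rewrite -ler_pdivlMr// ler_pdivrMr; last by lra.
  by rewrite mulrAC ltW.
have [xy|yx] := leP x y.
  apply: (H (x / 2)) => //; first by rewrite gtr0_norm//; lra.
  by rewrite /r ler0_norm; [field; lra|lra].
apply: (H (- (x / 2))); first by rewrite normrN gtr0_norm//; lra.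
  by rewrite /r gtr0_norm; [field; lra|lra].
by rewrite /M opprK [X in X + 1]addrC.
Qed.

(* Subtracting the chord of [f] through 1 and 2 leaves a convex function that
   is nonnegative on ]0, 1] and vanishes at 1, hence nonincreasing there. *)
Lemma fzero_cvg {R : realType} (f : R -> R) :
  convex_pos f -> f 1 = 0 -> (f t)%:E @[t --> 0^'+] --> fzero f.
Proof.
move=> fc f1.
pose g t := f t - f 2 * (t - 1).
have g0 t : 0 < t -> t < 1 -> 0 <= g t.
  move=> t0 t1.
  have := fc t 2 ((2 - t)^-1) t0 ltac:(lra).
  have -> : (2 - t)^-1 * t + (1 - (2 - t)^-1) * 2 = 1 by field; lra.
  have -> : (2 - t)^-1 * f t + (1 - (2 - t)^-1) * f 2 = g t / (2 - t).
    by rewrite /g; field; lra.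
  rewrite f1 ler_pdivlMr ?mul0r; last by lra.
  by apply; rewrite invr_ge0 invf_le1; lra.
have gn : {in `]0, 1[ &, {homo (fun t => (g t)%:E) : n m / n <= m >-> (m <= n)%E}}.
  move=> s t; rewrite !in_itv /= => /andP[s0 s1] /andP[t0 t1] st.
  rewrite lee_fin.
  have := fc s 1 ((1 - t) / (1 - s)) s0 ltr01.
  have -> : (1 - t) / (1 - s) * s + (1 - (1 - t) / (1 - s)) * 1 = t by field; lra.
  have h : 0 <= (1 - t) / (1 - s) <= 1.
    by rewrite divr_ge0 ?ler_pdivrMr//=; lra.
  move=> /(_ h); rewrite f1 mulr0 addr0 => h1.
  have g0s := g0 s s0 s1.
  apply: (@le_trans _ _ ((1 - t) / (1 - s) * g s)); last by case/andP: h; nra.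
  rewrite /g [leRHS]mulrBr.
  have -> : (1 - t) / (1 - s) * (f 2 * (s - 1)) = f 2 * (t - 1) by field; lra.
  lra.
have := @nonincreasing_at_right_cvge R (fun t => (g t)%:E) 0 (BLeft 1)
  ltac:(by rewrite bnd_simp ltr01) gn.
set l := ereal_sup _ => gl.
have lin : (f 2 * (t - 1))%:E @[t --> (0 : R)^'+] --> (f 2 * (0 - 1))%:E.
  apply: cvg_EFin; first by near=> t.
  apply: cvgM; first exact: cvg_cst.
  by apply: cvgB; [apply: cvg_at_right_filter; exact: cvg_id|exact: cvg_cst].
(* [l] may be [+oo]; the sum of limits is defined because the linear term has a finite limit. *)
have : (f t)%:E @[t --> 0^'+] --> (l + (f 2 * (0 - 1))%:E)%E.
  have := cvgeD _ gl lin.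
  rewrite (_ : (fun _ => _) = (fun t => (f t)%:E)); last first.
    by apply/funext => t; rewrite -EFinD /g; congr EFin; ring.
  by apply; rewrite fin_num_adde_defl.
by move=> h; rewrite /fzero (cvg_lim _ h).
Unshelve. all: by end_near.
Qed.

(** Meant for ratios moving from 1 to [r]. If [r = 0], the finite value at 0 is continued as a
    constant to the left; if [r > 0], the value at 0 may be infinite but is never reached. *)
Lemma fext_continuous {R : realType} (f : R -> R) (r : R) :
  convex_pos f -> f 1 = 0 -> 0 <= r -> fext f r \is a fin_num ->
  exists2 h : R -> R, continuous h &
    forall t, Num.min 1 r <= t -> fext f t = (h t)%:E.
Proof.
move=> fc f1; rewrite le_eqVlt => /predU1P[<- {r}|r0 _].
  rewrite /fext eqxx => fin0.
  exists (fun t => if t <= 0 then fine (fzero f) else f t); last first.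
    move=> t; rewrite (min_idPr ler01) => t0.
    by case: (ltgtP t 0) t0 => // _ _; rewrite fineK.
  move=> x; rewrite /continuous_at; have [x0|x0|->] := ltgtP x 0.
  - refine (cvg_trans _ (@cvg_cst _ (fine (fzero f)) _ _ _)).
    apply: near_eq_cvg; near=> t.
    have -> // : t <= 0.
    by apply: ltW; near: t; exact: lt_nbhsl.
  - refine (cvg_trans _ (@convex_pos_continuous _ f x fc x0)).
    apply: near_eq_cvg; near=> t.
    rewrite leNgt.
    have -> // : 0 < t.
    by near: t; exact: lt_nbhsr.
  - have := left_right_continuousP (fun t => if t <= 0 then fine (fzero f) else f t) 0.
    rewrite lexx => <-; split.
      refine (cvg_trans _ (@cvg_cst _ (fine (fzero f)) _ _ _)).
      apply: near_eq_cvg; near=> t.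
      have -> // : t <= 0.
      by near: t; exact: nbhs_left_le.
    have := fzero_cvg fc f1; rewrite -[fzero f in X in X -> _]fineK// => /fine_cvg.
    apply: cvg_trans.
    apply: near_eq_cvg; near=> t.
    rewrite leNgt.
    have -> // : 0 < t.
    by near: t; exact: nbhs_right_gt.
set m := Num.min 1 r.
have m0 : 0 < m by rewrite lt_min ltr01.
(* Clamping at [m > 0] keeps the argument away from 0. *)
exists (fun t => f (Num.max m t)); last first.
  move=> t mt; rewrite (max_idPr _)// /fext gt_eqF//; exact: lt_le_trans mt.
move=> x; apply: (@continuous_comp _ _ _ (fun t => Num.max m t) f).
  by apply: (@continuous_max _ _ (cst m) id); [exact: (@cvg_cst _ m)|exact: cvg_id].
by apply: convex_pos_continuous => //; rewrite lt_max m0.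
Unshelve. all: first [by end_near|exact _].
Qed.

(** * The perspective of a convex function *)

Section Perspective.
Context {R : realType}.
Implicit Types (f : R -> R) (p q c : R).

(** At [q = 0] the recession slope [fstar0 f] takes over, so that both terms of a divergence become
    a single sum or integral; since [0 * oo = 0], the value at [p = q = 0] is 0. *)
Definition perspective f p q : \bar R :=
  if q == 0 then (fstar0 f * p%:E)%E else (fext f (p / q) * q%:E)%E.

(** Lets weights be absorbed into both distributions; the convention [0 * oo = 0] covers [c = 0]. *)
Lemma perspectiveZ f c p q : 0 <= c -> 0 <= q ->
  perspective f (c * p) (c * q) = (c%:E * perspective f p q)%E.
Proof.
move=> c0 q0; rewrite /perspective mulf_eq0.
have [->|cn0] /= := eqVneq c 0; first by rewrite !mul0r mule0 mul0e.
have [_|qn0] /= := eqVneq q 0; first by rewrite EFinM muleCA.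
by rewrite -mulf_div divff// mul1r EFinM muleCA.
Qed.

Lemma perspective_diag f p : f 1 = 0 -> perspective f p p = 0%E.
Proof.
move=> f1; rewrite /perspective; have [->|p0] := eqVneq p 0.
  by rewrite mule0.
by rewrite divff// /fext oner_eq0 f1 mul0e.
Qed.

Lemma fdiv_finE f n (p q : 'I_n -> R) :
  (forall i, 0 <= p i) -> (forall i, 0 <= q i) ->
  fdiv_fin f p q = (\sum_(i < n) perspective f (p i) (q i))%E.
Proof.
move=> p0 q0; rewrite [RHS](bigID (fun i => 0 < q i)) /=; congr (_ + _)%E.
  by apply: eq_bigr => i /gt_eqF qi; rewrite /perspective qi.
rewrite -sumEFin ge0_sume_distrr; last by move=> i _; rewrite lee_fin.
apply: eq_big => i.
  by rewrite -leNgt eq_le q0 andbT.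
by rewrite /perspective => ->.
Qed.

(** For [q = 0] the value is linear in [s]. For [q > 0] the ratio is [1 + s * (p / q - 1)], which
    stays between 1 and [p / q], where [fext_continuous] applies. *)
Lemma perspective_path f p q a : convex_pos f -> f 1 = 0 ->
  0 <= p -> 0 <= q -> perspective f p q = a%:E ->
  exists phi : R -> R, [/\ continuous phi, phi 1 = a &
    forall s, 0 <= s <= 1 ->
      perspective f ((1 - s) * q + s * p) q = (phi s)%:E].
Proof.
move=> fc f1 p0 q0; rewrite /perspective; case: eqVneq => [->|qn0] pa.
  exists (fun s => s * a); split; [|by rewrite mul1r|].
    by move=> x; apply: continuousM; [exact: cvg_id|exact: cvg_cst].
  by move=> s _; rewrite mulr0 add0r EFinM muleCA pa.
have {}q0 : 0 < q by rewrite lt_neqAle eq_sym qn0.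
have fin : fext f (p / q) \is a fin_num.
  have : (fext f (p / q) * q%:E)%E \is a fin_num by rewrite pa.
  apply: contraTT => /fin_numPn[] ->.
    by rewrite gt0_mulNye.
  by rewrite gt0_mulye.
have [h hc hE] := @fext_continuous _ f _ fc f1 (divr_ge0 p0 (ltW q0)) fin.
exists (fun s => h (1 + s * (p / q - 1)) * q); split.
- move=> x.
  have c1 : {for x, continuous (fun s : R => 1 + s * (p / q - 1))}.
    apply: continuousD; first exact: cvg_cst.
    by apply: continuousM; [exact: cvg_id|exact: cvg_cst].
  have c2 := continuous_comp c1 (hc _).
  by apply: (continuousM c2); exact: cvg_cst.
- apply: EFin_inj; rewrite EFinM mul1r addrC subrK -hE ?pa//.
  by rewrite ge_min lexx orbT.
- move=> s /andP[s0 s1]; rewrite EFinM -hE.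
    by congr (fext f _ * _)%E; field.
  have [rl|rl] := leP 1 (p / q).
    by rewrite lerDl mulr_ge0// subr_ge0.
  have -> : 1 + s * (p / q - 1) = p / q + (1 - s) * (1 - p / q) by ring.
  by rewrite lerDl mulr_ge0//; lra.
Qed.

End Perspective.

(** * Finite distributions and their mixtures *)

Section Mixtures.
Context {R : realType} (f g : R -> R).

(** Infinities do not cancel in [\bar R], so a finite sum has only finite summands. *)
Lemma fdiv_fin_fine n (p q : 'I_n -> R) :
  (forall i, 0 <= p i) -> (forall i, 0 <= q i) -> forall (h : R -> R) z,
  fdiv_fin h p q = z%:E <->
  exists2 a : 'I_n -> R, forall i, perspective h (p i) (q i) = (a i)%:E &
    z = \sum_i a i.
Proof.
move=> p0 q0 h z; rewrite fdiv_finE//; split => [hz|[a ha ->]]; last first.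
  by rewrite -sumEFin; apply: eq_bigr.
have hf i : perspective h (p i) (q i) \is a fin_num.
  have : (\sum_(i < n) perspective h (p i) (q i))%E \is a fin_num by rewrite hz.
  by move=> /sum_fin_numP; apply; rewrite ?mem_index_enum.
exists (fun i => fine (perspective h (p i) (q i))) => [i|]; first by rewrite fineK.
apply: EFin_inj; rewrite -hz -sumEFin; apply: eq_bigr => i _.
by rewrite fineK.
Qed.

Lemma achievable_fin_diag : f 1 = 0 -> g 1 = 0 -> achievable_fin f g 2 0 0.
Proof.
move=> f1 g1; have v : prob_vec (fun _ : 'I_2 => 2^-1 : R).
  split => [i|]; first by rewrite invr_ge0.
  by rewrite big_ord_recl big_ord1; field.
exists (fun=> 2^-1), (fun=> 2^-1); do ![split=> //].
all: rewrite fdiv_finE; try (by move=> i; rewrite invr_ge0).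
all: by rewrite big1// => i _; rewrite perspective_diag.
Qed.

(** The two pairs of distributions occupy disjoint blocks with weights [lam] and [1 - lam]; by
    homogeneity each block contributes its divergence times its weight. *)
Lemma achievable_fin_add m n (lam x1 y1 x2 y2 : R) : 0 <= lam <= 1 ->
  achievable_fin f g m x1 y1 -> achievable_fin f g n x2 y2 ->
  achievable_fin f g (m + n)
    (lam * x1 + (1 - lam) * x2) (lam * y1 + (1 - lam) * y2).
Proof.
move=> /andP[l0 l1] [p1 [q1 [[p10 p1s] [[q10 q1s] [x1E y1E]]]]].
move=> [p2 [q2 [[p20 p2s] [[q20 q2s] [x2E y2E]]]]].
have l1' : 0 <= 1 - lam by lra.
pose mix (u : 'I_m -> R) (v : 'I_n -> R) (i : 'I_(m + n)) :=
  match fintype.split i with inl j => lam * u j | inr k => (1 - lam) * v k end.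
have mix0 u v : (forall i, 0 <= u i) -> (forall i, 0 <= v i) ->
    forall i, 0 <= mix u v i.
  by move=> u0 v0 i; rewrite /mix; case: fintype.split => j; rewrite mulr_ge0.
have splitl (j : 'I_m) : fintype.split (lshift n j) = inl j by exact: (unsplitK (inl j)).
have splitr (j : 'I_n) : fintype.split (rshift m j) = inr j by exact: (unsplitK (inr j)).
have mixs u v : (forall i, 0 <= u i) -> (forall i, 0 <= v i) ->
    \sum_i u i = 1 -> \sum_i v i = 1 -> prob_vec (mix u v).
  move=> u0 v0 us vs; split; first exact: mix0.
  rewrite big_split_ord /=.
  under eq_bigr do rewrite /mix splitl.
  under [X in _ + X]eq_bigr do rewrite /mix splitr.
  by rewrite -!mulr_sumr us vs; ring.
have mixE (h : R -> R) z1 z2 : fdiv_fin h p1 q1 = z1%:E -> fdiv_fin h p2 q2 = z2%:E ->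
    fdiv_fin h (mix p1 p2) (mix q1 q2) = (lam * z1 + (1 - lam) * z2)%:E.
  move=> /(fdiv_fin_fine p10 q10)[a aE ->].
  move=> /(fdiv_fin_fine p20 q20)[b bE ->].
  apply/fdiv_fin_fine; [exact: mix0|exact: mix0|].
  exists (mix a b) => [i|].
    by rewrite /mix; case: fintype.split => j; rewrite perspectiveZ// ?aE ?bE.
  rewrite big_split_ord /= !mulr_sumr.
  by congr (_ + _); apply: eq_bigr => i _; rewrite /mix ?splitl ?splitr.
exists (mix p1 p2), (mix q1 q2).
do ![split]; first [exact: mix0|by apply mixs|exact: mixE].
Qed.

End Mixtures.

(** * Separation by slopes and planar triangles *)

(** The crossing condition says that every slope [v j / u j] on the left of the vertical axis is at
    most every slope on the right; [c] is the infimum of the slopes on the right. *)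
Lemma slope_separation {R : realType} (I : Type) (P : I -> Prop) (u v : I -> R) :
  (exists2 i, P i & 0 < u i) -> (exists2 i, P i & u i < 0) ->
  (forall i, P i -> u i = 0 -> 0 <= v i) ->
  (forall i j, P i -> P j -> 0 < u i -> u j < 0 ->
     0 <= - u j * v i + u i * v j) ->
  exists c, forall i, P i -> c * u i <= v i.
Proof.
move=> [i0 Pi0 ui0] [j0 Pj0 uj0] h0 h.
pose E : set R := [set v i / u i | i in [set i | P i /\ 0 < u i]].
have E0 : E !=set0 by exists (v i0 / u i0), i0.
have lbE j : P j -> u j < 0 -> lbound E (v j / u j).
  move=> Pj uj _ [i [Pi ui] <-].
  have := h i j Pi Pj ui uj.
  rewrite ler_ndivrMr// mulrAC ler_pdivrMr//.
  by move=> *; lra.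
exists (inf E) => i Pi; have [ui|ui|ui] := ltgtP (u i) 0.
- rewrite -ler_ndivrMr//; apply: lb_le_inf => //; exact: lbE.
- rewrite -ler_pdivlMr//; apply: ge_inf; last by exists i.
  by exists (v j0 / u j0); exact: lbE.
- by rewrite ui mulr0; exact: h0.
Qed.

Section PlanarStar.
Context {R : realType} (S : R -> R -> Prop).

Definition on_segment x y := exists lam x1 y1 x2 y2 : R, [/\ 0 <= lam <= 1,
  S x1 y1, S x2 y2, x = lam * x1 + (1 - lam) * x2 & y = lam * y1 + (1 - lam) * y2].

Hypothesis S00 : S 0 0.
Hypothesis S_path : forall x y, S x y -> exists phi psi : R -> R,
  [/\ continuous phi, continuous psi, phi 0 = 0 /\ psi 0 = 0, phi 1 = x /\ psi 1 = y &
    forall s, 0 <= s <= 1 -> S (phi s) (psi s)].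

(* The zero-crossing is taken along the path from the origin to (x1, y1), in
   barycentric coordinates A, B, 1 - A - B relative to (x1, y1), (x2, y2) and
   the origin: where A / a = max (B / b) ((1 - A - B) / c), the target lies
   between the current point of the path and (x2, y2) or the origin. *)
Lemma triangle_segment x1 y1 x2 y2 a b : S x1 y1 -> S x2 y2 ->
  0 <= a -> 0 <= b -> a + b <= 1 ->
  on_segment (a * x1 + b * x2) (a * y1 + b * y2).
Proof.
move=> S1 S2 a0 b0 ab.
have [->|an0] := eqVneq a 0.
  exists b, x2, y2, 0, 0; split=> //; try ring; lra.
have [->|bn0] := eqVneq b 0.
  exists a, x1, y1, 0, 0; split=> //; try ring; lra.
have [ab1|abn1] := eqVneq (a + b) 1.
  have -> : b = 1 - a by lra.
  exists a, x1, y1, x2, y2; split=> //; lra.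
have {an0}a_gt0 : 0 < a by rewrite lt_neqAle eq_sym an0.
have {bn0}b_gt0 : 0 < b by rewrite lt_neqAle eq_sym bn0.
pose c := 1 - a - b.
have c_gt0 : 0 < c by rewrite /c; move: ab; rewrite le_eqVlt (negPf abn1) /=; lra.
(* If this determinant is 0, the vertices are collinear with the origin, and the target already lies
   on a segment from the origin to one of them. *)
pose D := x1 * y2 - x2 * y1.
have [D0|Dn0] := eqVneq D 0.
  have [[x10 y10]|[k [kx ky]]] : x1 = 0 /\ y1 = 0 \/ exists k, x2 = k * x1 /\ y2 = k * y1.
    have [x10|x1n0] := eqVneq x1 0.
      have [y10|y1n0] := eqVneq y1 0; first by left.
      right; exists (y2 / y1); split; last by field.
      rewrite x10 mulr0; apply/eqP; move/eqP: D0.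
      by rewrite /D x10 mul0r sub0r oppr_eq0 mulf_eq0 (negPf y1n0) orbF.
    right; exists (x2 / x1); split; first by field.
    by apply: (mulfI x1n0); rewrite (subr0_eq D0); field.
  - by exists b, x2, y2, 0, 0; rewrite x10 y10; split=> //; try ring; lra.
  - have xE : a * x1 + b * x2 = (a + b * k) * x1 by rewrite kx; ring.
    have yE : a * y1 + b * y2 = (a + b * k) * y1 by rewrite ky; ring.
    (* The target is [a + b * k] times (x1, y1). A factor outside [0, 1] forces [k < 0] or [1 < k],
       and then the target lies between the origin and (x2, y2). *)
    have [t0|t0] := ltP (a + b * k) 0; [|have [t1|t1] := ltP 1 (a + b * k)].
    + have k0 : k < 0 by nra.
      exists (a / k + b), x2, y2, 0, 0; split=> //.
      * apply/andP; split.
          by rewrite -(@ler_nM2l _ k)// mulr0 mulrDr mulrCA divff ?lt_eqF//; lra.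
        by rewrite -(@ler_nM2l _ k)// mulrDr mulrCA divff ?lt_eqF//; nra.
      * by rewrite kx; field; rewrite lt_eqF.
      * by rewrite ky; field; rewrite lt_eqF.
    + have k1 : 1 < k by nra.
      have k0 : 0 < k by lra.
      exists (a / k + b), x2, y2, 0, 0; split=> //.
      * apply/andP; split; first by rewrite addr_ge0// divr_ge0// ltW.
        by rewrite -(@ler_pM2l _ k)// mulrDr mulrCA divff ?gt_eqF//; nra.
      * by rewrite kx; field; rewrite gt_eqF.
      * by rewrite ky; field; rewrite gt_eqF.
    + exists (a + b * k), x1, y1, 0, 0; split => //; rewrite ?xE ?yE; try ring.
      by rewrite t0 t1.
have [phi [psi [cphi cpsi [phi0 psi0] [phi1 psi1] Sphi]]] := S_path S1.
pose A s := (phi s * y2 - psi s * x2) / D.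
pose B s := (x1 * psi s - y1 * phi s) / D.
pose h s := A s / a - Num.max (B s / b) ((1 - A s - B s) / c).
have ctsM k (k1 : R -> R) : continuous k1 -> continuous (fun s : R => k1 s * k).
  by move=> ck s; apply: (continuousM (ck s)); exact: cvg_cst.
have cA : continuous A.
  apply: (ctsM) => s; apply: (continuousB (ctsM _ _ cphi s) (ctsM _ _ cpsi s)).
have cB : continuous B.
  have -> : B = fun s => (psi s * x1 - phi s * y1) / D.
    by apply/funext => s; rewrite /B; ring.
  apply: (ctsM) => s; apply: (continuousB (ctsM _ _ cpsi s) (ctsM _ _ cphi s)).
have ch : continuous h.
  move=> s; apply: (continuousB (ctsM _ _ cA s)).
  apply: continuous_max; first exact: (ctsM).
  apply: (ctsM) => {}s; apply: continuousB (cB s).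
  by apply: continuousB (cA s); exact: cvg_cst.
have h0 : h 0 <= 0.
  rewrite /h /A /B phi0 psi0 !(mul0r, mulr0, subr0, sub0r, oppr0) oppr_le0.
  by rewrite le_max divr_ge0 ?(ltW c_gt0) ?orbT.
have h1 : 0 <= h 1.
  have A1 : A 1 = 1 by rewrite /A phi1 psi1 [y1 * x2]mulrC divff.
  have B1 : B 1 = 0 by rewrite /B phi1 psi1 [y1 * _]mulrC subrr mul0r.
  by rewrite /h A1 B1 !(subrr, subr0, mul0r) maxxx subr0 mul1r invr_ge0 ltW.
have [s] := @IVT _ h 0 1 0 ler01 (continuous_subspaceT ch)
  ltac:(by rewrite ge_min h0 le_max h1 orbT).
rewrite in_itv /= => s01 hs.
have Ss := Sphi s s01.
have phiE : phi s = A s * x1 + B s * x2.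
  by rewrite /A /B /D; field; exact: Dn0.
have psiE : psi s = A s * y1 + B s * y2.
  by rewrite /A /B /D; field; exact: Dn0.
move/eqP: hs; rewrite /h subr_eq0 => /eqP.
(* The coordinates of the path point are at most [k] times those of the target, and both triples sum
   to 1, so [1 <= k]. The target combines the path point, with weight [k^-1], and the vertex whose
   coordinate may fall short. *)
set k := A s / a; have Ak : A s = k * a by rewrite /k divfK// gt_eqF.
case: (leP (B s / b) ((1 - A s - B s) / c)) => [|/ltW] le kE.
- have Ck : 1 - A s - B s = k * c by rewrite kE divfK// gt_eqF.
  have Bk : B s <= k * b by rewrite kE -ler_pdivrMr.
  have k1 : 1 <= k by rewrite /c in Ck; nra.
  have k0 : 0 < k by lra.
  have Bs : B s = 1 - k * (1 - b) by rewrite /c in Ck; lra.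
  exists k^-1, (phi s), (psi s), x2, y2; split=> //.
  + by rewrite invr_ge0 invf_le1// k1 ltW.
  + by rewrite phiE Ak Bs; field; rewrite gt_eqF.
  + by rewrite psiE Ak Bs; field; rewrite gt_eqF.
- have Bk : B s = k * b by rewrite kE divfK// gt_eqF.
  have Ck : 1 - A s - B s <= k * c by rewrite kE -ler_pdivrMr.
  have k1 : 1 <= k by rewrite /c in Ck; nra.
  have k0 : 0 < k by lra.
  exists k^-1, (phi s), (psi s), 0, 0; split=> //.
  + by rewrite invr_ge0 invf_le1// k1 ltW.
  + by rewrite phiE Ak Bk; field; rewrite gt_eqF.
  + by rewrite psiE Ak Bk; field; rewrite gt_eqF.
Qed.

End PlanarStar.

(** * Finite integrals, and pairs of points for a centered function *)

Section Integral.
Context {R : realType} d (T : measurableType d) (mu : {measure set T -> \bar R}).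
Implicit Types (H K : T -> R) (A : set T).

Definition has_integral H (h : R) :=
  mu.-integrable setT (EFin \o H) /\ (\int[mu]_x (H x)%:E = h%:E)%E.

Lemma has_integralD H K h k : has_integral H h -> has_integral K k ->
  has_integral (fun x => H x + K x) (h + k).
Proof.
move=> [iH hE] [iK kE]; split.
  exact: (integrableD measurableT iH iK).
under eq_integral do rewrite EFinD.
by rewrite (integralD_EFin measurableT iH iK) /= hE kE.
Qed.

Lemma has_integralZ H h c : has_integral H h ->
  has_integral (fun x => c * H x) (c * h).
Proof.
move=> [iH hE]; split.
  exact: (integrableZl measurableT c iH).
under eq_integral do rewrite EFinM.
by rewrite (integralZl measurableT iH) hE.
Qed.

Lemma has_integralB H K h k : has_integral H h -> has_integral K k ->
  has_integral (fun x => H x - K x) (h - k).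
Proof.
move=> iH /(has_integralZ (-1)) /(has_integralD iH).
rewrite mulN1r; congr (has_integral _ _).
by apply/funext => x; rewrite mulN1r.
Qed.

Lemma has_integral0_ae H : has_integral H 0 -> {ae mu, forall x, 0 <= H x} ->
  {ae mu, forall x, H x = 0}.
Proof.
move=> [iH hE] Hge0.
have mH := measurable_int _ iH.
have : (\int[mu]_x `|(EFin \o H) x| = 0)%E.
  transitivity (\int[mu]_x (H x)%:E)%E; last exact: hE.
  apply: ae_eq_integral => //.
    exact: measurable_int (integrable_abse iH).
  by apply: filterS Hge0 => x Hx _ /=; rewrite ger0_norm.
move/(ae_eq_integral_abs mu measurableT mH).
by apply: filterS => x /(_ I) [].
Qed.

Lemma has_integral_ae H h : has_integral H h -> {ae mu, forall x, H x = 0} -> h = 0.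
Proof.
move=> [iH hE] H0; apply: EFin_inj; rewrite -hE.
rewrite (ae_eq_integral (cst 0%E)) ?integral0//; first exact: (measurable_int _ iH).
by apply: filterS H0 => x -> _.
Qed.

Context (U : T -> R).
Hypothesis U_int : has_integral U 0.
Hypothesis U_neq0 : ~ {ae mu, forall x, U x = 0}.

(** Otherwise [U <= 0] almost everywhere, and the zero integral forces [U = 0] almost everywhere. *)
Lemma pos_ae A : {ae mu, forall x, A x} -> exists2 x, A x & 0 < U x.
Proof.
move=> Aae; apply: contrapT => nA; apply: U_neq0.
have h := has_integralZ (-1) U_int; rewrite mulr0 in h.
apply: (filterS _ (has_integral0_ae h _)) => [x /eqP|].
  by rewrite mulN1r oppr_eq0 => /eqP.
apply: filterS Aae => x Ax; rewrite mulN1r oppr_ge0 leNgt.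
by apply/negP => Ux; apply: nA; exists x.
Qed.

End Integral.

(* A pair (s, t) with [U t < 0 < U s] carries the two-point measure with weights
   [- U t] and [U s], for which [U] is centered; [pairing H] is, up to
   normalisation, the expectation of [H]. *)
Definition pairing {R : realType} (T : Type) (U H : T -> R)
    (i : T * T) :=
  - U i.2 * H i.1 + U i.1 * H i.2.
Definition pairs {R : realType} (T : Type) (U : T -> R) (A : set T) :
    set (T * T) :=
  [set i | [/\ A i.1, A i.2, 0 < U i.1 & U i.2 < 0]].

Section Pairs.
Context {R : realType} d (T : measurableType d) (mu : {measure set T -> \bar R}).
Implicit Types (H K : T -> R) (A : set T).
Context (U : T -> R).
Hypothesis U_int : has_integral mu U 0.
Hypothesis U_neq0 : ~ {ae mu, forall x, U x = 0}.

Lemma neg_ae A : {ae mu, forall x, A x} -> exists2 x, A x & U x < 0.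
Proof.
move=> Aae; have h := has_integralZ (-1) U_int; rewrite mulr0 in h.
have n : ~ {ae mu, forall x, -1 * U x = 0}.
  apply: contra_not U_neq0; apply: filterS => x /eqP.
  by rewrite mulN1r oppr_eq0 => /eqP.
have [x Ax] := pos_ae h n Aae.
by rewrite mulN1r oppr_gt0; exists x.
Qed.

(** Slope separation over the sample points gives [c * U <= H] on [A]; the difference is nonnegative
    with integral 0, hence vanishes almost everywhere. *)
Lemma ae_proportional A H : {ae mu, forall x, A x} -> has_integral mu H 0 ->
  (forall x, A x -> U x = 0 -> 0 <= H x) ->
  (forall i, pairs U A i -> 0 <= pairing U H i) ->
  exists c, {ae mu, forall x, H x = c * U x}.
Proof.
move=> Aae H_int H0 Hp.
have [||||c hc] := @slope_separation _ _ A U H.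
- exact: (pos_ae U_int U_neq0 Aae).
- exact: (neg_ae Aae).
- exact: H0.
- by move=> s t As At Us Ut; apply: (Hp (s, t)).
exists c; have := has_integralB H_int (has_integralZ c U_int).
rewrite mulr0 subr0 => /has_integral0_ae h.
have {}h : {ae mu, forall x, H x - c * U x = 0}.
  by apply: h; apply: filterS Aae => x /hc; rewrite subr_ge0.
by apply: filterS h => x /subr0_eq.
Qed.

(** If all pairings were positive, [H] would be almost everywhere a multiple of [U]; but the pairing
    of [U] with a multiple of itself is 0. *)
Lemma pairing_le0 A H : {ae mu, forall x, A x} -> has_integral mu H 0 ->
  (forall x, A x -> U x = 0 -> 0 <= H x) ->
  exists2 i, pairs U A i & pairing U H i <= 0.
Proof.
move=> Aae H_int H0; apply: contrapT => np.
have [|c Hc] := ae_proportional Aae H_int H0.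
  move=> i Ai; rewrite leNgt; apply/negP => Hi; apply: np; exists i => //.
  exact: ltW.
have AHae : {ae mu, forall x, (A `&` [set x | H x = c * U x]) x}.
  by apply: filterS2 Aae Hc => x.
have [s [As Hs] Us] := pos_ae U_int U_neq0 AHae.
have [t [At Ht] Ut] := neg_ae AHae.
apply: np; exists (s, t) => //; rewrite /pairing /= Hs Ht.
by rewrite (_ : _ + _ = 0)//; ring.
Qed.

End Pairs.

Lemma pairing_comb {R : realType} (T : Type) (U H K : T -> R) (a b : R) i :
  pairing U (fun s => a * H s + b * K s) i = a * pairing U H i + b * pairing U K i.
Proof. by rewrite /pairing; ring. Qed.

(** At a pair (s, t) the pairing equals [p s * q t - p t * q s], where [p s > q s] and
    [q t > p t]. *)
Lemma pairing_mass {R : realType} (T : Type) (p q : T -> R) (A : set T) i :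
  (forall s, 0 <= p s) -> (forall s, 0 <= q s) ->
  pairs (fun s => p s - q s) A i -> 0 < pairing (fun s => p s - q s) q i.
Proof.
move=> p_ge0 q_ge0; case: i => s t [_ _ /=].
rewrite subr_gt0 subr_lt0 /pairing /= => Us Ut.
have := p_ge0 t; have := q_ge0 s; nra.
Qed.

(** * A triangle around the point to be represented *)

Section Triangle.
Context {R : realType} d (T : measurableType d) (mu : {measure set T -> \bar R}).
Context (p q F G : T -> R) (x y : R) (A : set T) (S : R -> R -> Prop).
Let U s := p s - q s.
Hypotheses (p_int : has_integral mu p 1) (q_int : has_integral mu q 1).
Hypotheses (F_int : has_integral mu F x) (G_int : has_integral mu G y).
Hypothesis A_ae : {ae mu, forall s, A s}.
Hypothesis p_ge0 : forall s, 0 <= p s.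
Hypothesis q_ge0 : forall s, 0 <= q s.
Hypothesis FG0 : forall s, A s -> U s = 0 -> F s = 0 /\ G s = 0.
Hypothesis S00 : S 0 0.
Hypothesis S_pair : forall i, pairs U A i ->
  S (pairing U F i / pairing U q i) (pairing U G i / pairing U q i).

(* With [S] the 2-achievable points: (x, y) lies in a triangle formed by the
   origin and two points of [S]. Here [m] vanishes on the line from the origin to
   (x, y), and [l] equals 1 at (x, y). If there were no such triangle, every
   convex combination of pair values on that line would have [l < 1], so some line
   through (x, y) would have all the pair values on one side; integrating, almost
   all pair values would lie on that line, and two of them would enclose (x, y). *)
Lemma barycenter_triangle : exists x1 y1 x2 y2 a b : R,
  [/\ S x1 y1, S x2 y2, [/\ 0 <= a, 0 <= b & a + b <= 1],
      x = a * x1 + b * x2 & y = a * y1 + b * y2].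
Proof.
apply: contrapT => noT.
have xy0 : ~ (x = 0 /\ y = 0).
  move=> [x0 y0]; apply: noT; exists 0, 0, 0, 0, 0, 0.
  by rewrite !mul0r addr0; split=> //; rewrite ler01 lexx.
have U_int : has_integral mu U 0 by have := has_integralB p_int q_int; rewrite subrr.
have U_neq0 : ~ {ae mu, forall s, U s = 0}.
  move=> U0; apply: xy0; split.
    apply: (has_integral_ae F_int); apply: filterS2 A_ae U0 => s As Us.
    by have [] := FG0 As Us.
  apply: (has_integral_ae G_int); apply: filterS2 A_ae U0 => s As Us.
  by have [] := FG0 As Us.
pose n := x ^+ 2 + y ^+ 2.
have n_gt0 : 0 < n.
  rewrite lt_neqAle eq_sym paddr_eq0 ?sqr_ge0// !sqrf_eq0 addr_ge0 ?sqr_ge0// andbT.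
  by apply/negP => /andP[/eqP ? /eqP ?]; apply: xy0.
pose m s := y * F s + - x * G s.
pose l s := x / n * F s + y / n * G s.
(* Divided by [pairing U q], the pairing of [e] is [1 - l] at the pair value. *)
pose e s := 1 * q s + - 1 * l s.
have m_int : has_integral mu m 0.
  have := has_integralD (has_integralZ y F_int) (has_integralZ (- x) G_int).
  by rewrite mulNr [x * y]mulrC subrr.
have e_int : has_integral mu e 0.
  have := has_integralD (has_integralZ (x / n) F_int) (has_integralZ (y / n) G_int).
  have -> : x / n * x + y / n * y = 1 by rewrite /n; field; rewrite gt_eqF.
  move=> /(has_integralZ (-1))/(has_integralD (has_integralZ 1 q_int)).
  by rewrite mulN1r mul1r subrr.
have m0 s : A s -> U s = 0 -> m s = 0.
  by move=> As /(FG0 As)[F0 G0]; rewrite /m F0 G0; ring.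
have e0 s : A s -> U s = 0 -> 0 <= e s.
  by move=> As /(FG0 As)[F0 G0]; rewrite /e /l F0 G0; have := q_ge0 s; lra.
pose PF := pairing U F; pose PG := pairing U G; pose Pq := pairing U q.
have Pm i : pairing U m i = y * PF i - x * PG i.
  by rewrite pairing_comb mulNr.
have Pe i : pairing U e i = Pq i - (x / n * PF i + y / n * PG i).
  by rewrite pairing_comb mul1r mulN1r pairing_comb.
(* Pair values combined so as to fall on the line through the origin and (x, y) have [l < 1].
   Otherwise [(X, Y)] is [L] times (x, y) with [L] at least the total mass, so the coefficients
   [a * Pq i / L] and [b * Pq j / L] sum to at most 1 and give a triangle excluded by [noT]. *)
have noline i j (a b : R) : pairs U A i -> pairs U A j -> 0 <= a -> 0 <= b ->
    0 < a + b -> a * pairing U m i + b * pairing U m j = 0 ->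
    0 < a * pairing U e i + b * pairing U e j.
  move=> Ai Aj a0 b0 ab; rewrite !Pm !Pe => ab0; rewrite ltNge; apply/negP => le1.
  pose X := a * PF i + b * PF j; pose Y := a * PG i + b * PG j.
  have XY : y * X = x * Y by rewrite /X /Y; lra.
  pose L := x / n * X + y / n * Y.
  have qi := pairing_mass p_ge0 q_ge0 Ai; have qj := pairing_mass p_ge0 q_ge0 Aj.
  have M0 : 0 < a * Pq i + b * Pq j.
    rewrite lt_neqAle eq_sym paddr_eq0 ?mulr_ge0 ?(ltW qi) ?(ltW qj)//.
    rewrite !mulf_eq0 (gt_eqF qi) (gt_eqF qj) !orbF.
    rewrite addr_ge0 ?mulr_ge0 ?(ltW qi) ?(ltW qj)// andbT.
    by apply/negP => /andP[/eqP ? /eqP ?]; lra.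
  have LM : a * Pq i + b * Pq j <= L by rewrite /L /X /Y; lra.
  have L0 : 0 < L by lra.
  have xE : x = X / L.
    apply: (mulIf (lt0r_neq0 L0)); rewrite divfK ?lt0r_neq0//.
    apply: (mulIf (lt0r_neq0 n_gt0)).
    have -> : x * L * n = x * (x * X) + y * (x * Y) by rewrite /L; field; rewrite gt_eqF.
    by rewrite -XY /n; ring.
  have yE : y = Y / L.
    apply: (mulIf (lt0r_neq0 L0)); rewrite divfK ?lt0r_neq0//.
    apply: (mulIf (lt0r_neq0 n_gt0)).
    have -> : y * L * n = x * (y * X) + y * (y * Y) by rewrite /L; field; rewrite gt_eqF.
    by rewrite XY /n; ring.
  apply: noT; exists (PF i / Pq i), (PG i / Pq i), (PF j / Pq j), (PG j / Pq j).
  exists (a * Pq i / L), (b * Pq j / L); split.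
  - exact: S_pair.
  - exact: S_pair.
  - split; [by rewrite divr_ge0 ?mulr_ge0// ltW|by rewrite divr_ge0 ?mulr_ge0// ltW|].
    by rewrite -mulrDl ler_pdivrMr// mul1r.
  - by rewrite [LHS]xE /X; field; rewrite !gt_eqF.
  - by rewrite [LHS]yE /Y; field; rewrite !gt_eqF.
(* Pairs exist strictly on each side of the line. If not, [m] is almost everywhere a multiple of
   [U], its pairings vanish over a set of full measure, and a pair there with [pairing U e i <= 0]
   contradicts [noline]. *)
have side (r : R) : r != 0 -> exists2 i, pairs U A i & 0 < r * pairing U m i.
  move=> r0; apply: contrapT => nside.
  have rm_int := has_integralZ (- r) m_int; rewrite mulr0 in rm_int.
  have Pr i : pairing U (fun s => - r * m s) i = - r * pairing U m i.
    by rewrite /pairing; ring.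
  have [||c hc] := ae_proportional U_int U_neq0 A_ae rm_int.
  - by move=> s As /(m0 s As) ->; rewrite mulr0.
  - move=> i Ai; rewrite Pr mulNr oppr_ge0 leNgt.
    by apply/negP => ?; apply: nside; exists i.
  have Bae : {ae mu, forall s, (A `&` [set s | - r * m s = c * U s]) s}.
    by apply: filterS2 A_ae hc.
  have [|i [[Ai1 mi1] [Ai2 mi2] Ui1 Ui2]] := pairing_le0 U_int U_neq0 Bae e_int.
    by move=> s [As _]; exact: e0.
  apply/negP; rewrite -ltNge.
  have Ai : pairs U A i by [].
  have := noline i i 1 0 Ai Ai ler01 (lexx _).
  rewrite !mul0r !addr0 !mul1r; apply; rewrite ?ltr01//.
  apply/eqP; rewrite -(mulrI_eq0 _ (mulfI (_ : - r != 0))) ?oppr_eq0// -Pr.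
  by rewrite /pairing mi1 mi2; apply/eqP; ring.
(* Slope separation of the pairs in the coordinates [m] and [e], with [noline] as crossing
   condition. The line [e = c * m] passes through (x, y), where both coordinates vanish. *)
have [c hc] : exists c, forall i, pairs U A i -> c * pairing U m i <= pairing U e i.
  apply: slope_separation.
  - by have [i Ai] := side 1 (oner_neq0 _); rewrite mul1r; exists i.
  - have [i Ai] := side (-1) ltac:(by rewrite oppr_eq0 oner_neq0).
    by rewrite mulN1r oppr_gt0; exists i.
  - move=> i Ai mi; have := noline i i 1 0 Ai Ai ler01 (lexx _).
    rewrite !mul0r !addr0 !mul1r => h; apply/ltW/h => //; exact: ltr01.
  - move=> i j Ai Aj mi mj.
    have n0 : 0 <= - pairing U m j by lra.
    have p0 : 0 < - pairing U m j + pairing U m i by lra.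
    by apply/ltW/(noline i j _ _ Ai Aj n0 (ltW mi) p0); ring.
(* [k] has integral 0 and nonnegative pairings, so it is almost everywhere a multiple of [U]; pairs
   from that set lie on the line [e = c * m]. *)
pose k s := 1 * e s + - c * m s.
have k_int : has_integral mu k 0.
  have := has_integralD (has_integralZ 1 e_int) (has_integralZ (- c) m_int).
  by rewrite !mulr0 addr0.
have Pk i : pairing U k i = pairing U e i - c * pairing U m i.
  by rewrite pairing_comb mul1r mulNr.
have [||c' hc'] := ae_proportional U_int U_neq0 A_ae k_int.
- by move=> s As Us; rewrite /k (m0 s As Us) mulr0 addr0 mul1r; exact: e0.
- by move=> i Ai; rewrite Pk subr_ge0; exact: hc.
have Bae : {ae mu, forall s, (A `&` [set s | k s = c' * U s]) s}.
  by apply: filterS2 A_ae hc'.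
have onB i : pairs U (A `&` [set s | k s = c' * U s]) i ->
    pairs U A i /\ pairing U e i = c * pairing U m i.
  move=> [[Ai1 ki1] [Ai2 ki2] Ui1 Ui2]; split=> //.
  by apply: subr0_eq; rewrite -Pk /pairing ki1 ki2; ring.
(* On this line one pair has [m <= 0] and another [m >= 0]; the combination that cancels [m] also
   cancels [e], against [noline]. *)
have [|i /onB[Ai ei] mi] := pairing_le0 U_int U_neq0 Bae m_int.
  by move=> s [As _] /(m0 s As) ->.
have nm_int := has_integralZ (- 1) m_int; rewrite mulr0 in nm_int.
have [|j /onB[Aj ej] mj] := pairing_le0 U_int U_neq0 Bae nm_int.
  by move=> s [As _] /(m0 s As) ->; rewrite mulr0.
have {}mj : 0 <= pairing U m j by move: mj; rewrite /pairing; lra.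
have [mi0|mi0] := eqVneq (pairing U m i) 0.
  have := noline i i 1 0 Ai Ai ler01 (lexx _).
  by rewrite !mul0r !addr0 !mul1r ei mi0 mulr0 ltxx => /(_ ltr01 erefl).
have {mi mi0} mi : pairing U m i < 0 by rewrite lt_neqAle mi0.
have n0 : 0 <= - pairing U m i by lra.
have p0 : 0 < pairing U m j + - pairing U m i by lra.
have := noline i j _ _ Ai Aj mj n0 p0.
rewrite ei ej => /(_ ltac:(ring)).
by rewrite (_ : _ + _ = 0) ?ltxx//; ring.
Qed.

End Triangle.

(** * Divergences as integrals of the perspective *)

Section PerspectiveIntegral.
Context {R : realType} d (T : measurableType d) (mu : {measure set T -> \bar R}).
Implicit Types (f : R -> R) (p q : T -> R).

Lemma measurable_perspective f p q : convex_pos f ->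
  measurable_fun setT p -> measurable_fun setT q ->
  (forall s, 0 <= p s) -> (forall s, 0 <= q s) ->
  measurable_fun setT ((fun s => perspective f (p s) (q s)) : T -> \bar R).
Proof.
move=> fc mp mq p0 q0.
have mr : measurable_fun setT (fun s => p s / q s).
  rewrite (_ : (fun _ => _) = (fun s => p s * q s `^ (-1))).
    apply: measurable_funM => //.
    exact: (@measurableT_comp _ _ _ _ _ _ (@powR R ^~ (-1))).
  by apply/funext => s; rewrite powR_inv1.
pose pos : set R := [set t | 0 < t].
have opos : open pos by exact: open_gt.
(* [f] is controlled only on the positive reals, so it is cut off to 0 elsewhere; the ratio 0 is
   treated as a separate case. *)
have mf : measurable_fun setT (f \_ pos).
  apply: (measurable_restrictT f (open_measurable opos)).1.
  apply: open_continuous_measurable_fun => //.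
  by move=> t /set_mem; exact: convex_pos_continuous.
rewrite (_ : (fun _ => _) = (fun s =>
    if q s == 0 then (fstar0 f * (p s)%:E)%E
    else ((if (p s / q s == 0)%R then fzero f else ((f \_ pos) (p s / q s)%R)%:E)
         * (q s)%:E)%E)); last first.
  apply/funext => s; rewrite /perspective; case: ifPn => // qn0.
  congr (_ * _)%E; rewrite /fext; case: ifPn => // rn0.
  rewrite patchE mem_set// /pos /= lt_neqAle eq_sym rn0.
  exact: divr_ge0.
apply: measurable_fun_ifT.
- by apply: measurable_fun_eqr => //; exact: measurable_cst.
- by apply: emeasurable_funM; [exact: measurable_cst|exact/measurable_EFinP].
- apply: emeasurable_funM; last exact/measurable_EFinP.
  apply: measurable_fun_ifT.
  + by apply: measurable_fun_eqr => //; exact: measurable_cst.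
  + exact: measurable_cst.
  + by apply/measurable_EFinP; exact: measurableT_comp mf mr.
Qed.

Lemma fdivE f p q : convex_pos f -> prob_density mu p -> prob_density mu q ->
  fdiv f mu p q = (\int[mu]_s perspective f (p s) (q s))%E.
Proof.
move=> fc [mp [p0 _]] [mq [q0 _]].
have mP := measurable_perspective fc mp mq p0 q0.
have mD0 : measurable [set s | 0 < q s].
  rewrite -[X in measurable X]setTI.
  have := measurable_fun_ltr (measurable_cst (0 : R)) mq.
  by move/(_ measurableT [set true] I).
have mD1 : measurable [set s | q s = 0].
  rewrite -[X in measurable X]setTI.
  have := mq measurableT [set 0] (measurable_set1 _).
  exact.
have UT : [set s | 0 < q s] `|` [set s | q s = 0] = setT.
  apply/seteqP; split=> // s _ /=.
  by have := q0 s; rewrite le_eqVlt => /predU1P[<-|]; [right|left].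
rewrite -[in RHS]UT integral_setU//; last 2 first.
- by rewrite UT.
- by apply/disj_setPS => s [/= q_gt0 qs0]; move: q_gt0; rewrite qs0 ltxx.
rewrite /fdiv; congr (_ + _)%E.
  by apply: eq_integral => s /set_mem /= qs; rewrite /perspective gt_eqF.
have mpE : measurable_fun [set s | q s = 0] (EFin \o p).
  by apply/measurable_EFinP; exact: measurable_funTS.
transitivity (\int[mu]_(s in [set s | q s = 0%R]) (fstar0 f * (p s)%:E))%E; last first.
  by apply: eq_integral => s /set_mem /= ->; rewrite /perspective eqxx.
(* The constant may be infinite and of either sign: a nonnegative one passes through the integral of
   the nonnegative [p], a negative one does so after a change of sign. *)
have [f0|/ltW f0] := leP 0%E (fstar0 f).
  by rewrite ge0_integralZl// => s _; rewrite lee_fin.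
rewrite -(oppeK (fstar0 f)) mulNe.
under [RHS]eq_integral do rewrite mulNe.
have nf0 : (0 <= - fstar0 f)%E by rewrite oppe_ge0.
rewrite integral_ge0N; last by move=> s _; rewrite mule_ge0// lee_fin.
by rewrite ge0_integralZl// => s _; rewrite lee_fin.
Qed.

(** The integral is the difference of those of the positive and negative parts, and a finite
    difference forces both to be finite. *)
Lemma integral_fin_integrable (h : T -> \bar R) : measurable_fun setT h ->
  (\int[mu]_s h s)%E \is a fin_num -> mu.-integrable setT h.
Proof.
move=> mh; rewrite integralE fin_numB => /andP[fp fn].
apply/integrableP; split=> //.
under eq_integral do rewrite -/((abse \o h) _) fune_abse.
rewrite ge0_integralD//.
- by rewrite lte_add_pinfty// -ge0_fin_numE// integral_ge0.
- exact: measurable_funepos.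
- exact: measurable_funeneg.
Qed.

(** A finite divergence makes the integrand integrable, hence finite almost everywhere, so [fine]
    alters it only on a null set. *)
Lemma fdiv_has_integral f p q z : convex_pos f -> prob_density mu p ->
  prob_density mu q -> fdiv f mu p q = z%:E ->
  {ae mu, forall s, perspective f (p s) (q s) \is a fin_num} /\
  has_integral mu (fun s => fine (perspective f (p s) (q s))) z.
Proof.
move=> fc pd qd; rewrite fdivE// => zE.
have mP : measurable_fun setT ((fun s => perspective f (p s) (q s)) : T -> \bar R).
  by case: pd qd => mp [p0 _] [mq [q0 _]]; exact: measurable_perspective.
have iP : mu.-integrable setT (fun s => perspective f (p s) (q s)).
  by apply: integral_fin_integrable; rewrite ?zE.
have fin : {ae mu, forall s, perspective f (p s) (q s) \is a fin_num}.
  by apply: filterS (integrable_ae measurableT iP) => s /(_ I).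
split=> //.
have mfP : measurable_fun setT
    ((fun s => (fine (perspective f (p s) (q s)))%:E) : T -> \bar R).
  by apply/measurable_EFinP;
     exact: (measurableT_comp (@fine_measurable R setT measurableT) mP).
have E : (\int[mu]_s (fine (perspective f (p s) (q s)))%:E = z%:E)%E.
  rewrite -zE; apply: ae_eq_integral => //.
  by apply: filterS fin => s fs _; rewrite fineK.
by split; [apply: integral_fin_integrable; rewrite ?E|].
Qed.

End PerspectiveIntegral.

(** * Two-point distributions *)

(** This sum of Dirac masses is the counting measure on [bool], the model of a two-element set as a
    measurable space. *)
Lemma integral_diracD {R : realType} (h : bool -> \bar R) :
  (forall b, h b \is a fin_num) ->
  (\int[measure_add \d_true \d_false]_b h b = h true + h false)%E.
Proof.
move=> hf.
have mh : measurable_fun setT h by [].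
have e b : (\int[\d_b]_s h s = h b)%E.
  by rewrite integral_dirac// diracT mul1e.
by rewrite integral_measure_add// ?e//; apply: integral_fin_integrable => //; rewrite e.
Qed.

Lemma achievable_fin2_achievable {R : realType} (f g : R -> R) x y :
  convex_pos f -> convex_pos g -> achievable_fin f g 2 x y -> achievable f g x y.
Proof.
move=> fc gc [p [q [[p0 ps] [[q0 qs] [xE yE]]]]].
pose b2o (b : bool) : 'I_2 := if b then ord0 else lift ord0 ord0.
have dens (u : 'I_2 -> R) : (forall i, 0 <= u i) -> \sum_i u i = 1 ->
    prob_density (measure_add \d_true \d_false) (u \o b2o).
  move=> u0 us; split; [by []|split=> [b|]]; first exact: u0.
  rewrite integral_diracD//= -EFinD -[RHS]/((1 : R)%:E) -us big_ord_recl big_ord1.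
  by [].
have pd := dens p p0 ps; have qd := dens q q0 qs.
have E (h : R -> R) z : convex_pos h -> fdiv_fin h p q = z%:E ->
    fdiv h (measure_add \d_true \d_false) (p \o b2o) (q \o b2o) = z%:E.
  move=> hc /(fdiv_fin_fine p0 q0)[a aE ->]; rewrite fdivE// integral_diracD.
    by rewrite /= !aE -EFinD big_ord_recl big_ord1.
  by move=> b; rewrite /= aE.
exists _, bool, (measure_add \d_true \d_false), (p \o b2o), (q \o b2o).
by do !split=> //; try exact: E; apply pd || apply qd.
Qed.

(** For the pair (s, t) the weights are [- U t / M] and [U s / M]. The same [M] normalises [p] and
    [q], since they differ by [U] and the pairing of [U] with itself is 0. *)
Lemma achievable_pair {R : realType} (f g : R -> R) (T : Type) (p q F G : T -> R)
    (A : set T) (i : T * T) :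
  (forall s, 0 <= p s) -> (forall s, 0 <= q s) ->
  (forall s, A s -> perspective f (p s) (q s) = (F s)%:E) ->
  (forall s, A s -> perspective g (p s) (q s) = (G s)%:E) ->
  let U s := p s - q s in pairs U A i ->
  achievable_fin f g 2 (pairing U F i / pairing U q i) (pairing U G i / pairing U q i).
Proof.
move=> p0 q0 FE GE U Ui; have M0 := pairing_mass p0 q0 Ui.
case: i Ui M0 => s t [/= As At Us Ut]; set M := pairing U q _ => M0.
pose mix (h : T -> R) (j : 'I_2) :=
  if j == ord0 then - U t / M * h s else U s / M * h t.
have lam0 : 0 <= - U t / M by rewrite divr_ge0 ?oppr_ge0// ltW.
have lam1 : 0 <= U s / M by rewrite divr_ge0// ltW.
have mixs h : \sum_j mix h j = pairing U h (s, t) / M.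
  by rewrite big_ord_recl big_ord1 /mix /= /pairing /=; field; rewrite gt_eqF.
have mix0 h : (forall s, 0 <= h s) -> forall j, 0 <= mix h j.
  by move=> h0 j; rewrite /mix; case: ifP => _; rewrite mulr_ge0.
have Mp : pairing U p (s, t) = M by rewrite /M /pairing /U /=; ring.
have E (h : R -> R) (H : T -> R) :
    (forall s, A s -> perspective h (p s) (q s) = (H s)%:E) ->
    fdiv_fin h (mix p) (mix q) = (pairing U H (s, t) / M)%:E.
  move=> HE; apply/fdiv_fin_fine; [exact: mix0|exact: mix0|].
  exists (mix H); last by rewrite mixs.
  by move=> j; rewrite /mix; case: ifP => _; rewrite perspectiveZ// HE.
exists (mix p), (mix q); split; [|split; [|split; exact: E]].
  by split; [exact: mix0|rewrite mixs Mp divff ?gt_eqF].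
by split; [exact: mix0|rewrite mixs divff ?gt_eqF].
Qed.

(** Each coordinate follows [perspective_path]; at [s = 0] the two distributions coincide, so the
    path starts at the origin. *)
Lemma achievable_fin_path {R : realType} (f g : R -> R) x y :
  convex_pos f -> convex_pos g -> f 1 = 0 -> g 1 = 0 ->
  achievable_fin f g 2 x y ->
  exists phi psi : R -> R,
  [/\ continuous phi, continuous psi, phi 0 = 0 /\ psi 0 = 0, phi 1 = x /\ psi 1 = y &
    forall s, 0 <= s <= 1 -> achievable_fin f g 2 (phi s) (psi s)].
Proof.
move=> fc gc f1 g1 [p [q [[p0 ps] [[q0 qs] [xE yE]]]]].
pose r s (i : 'I_2) := (1 - s) * q i + s * p i.
have r0 s : 0 <= s <= 1 -> forall i, 0 <= r s i.
  by move=> /andP[s0 s1] i; rewrite addr_ge0// mulr_ge0//; lra.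
have P (h : R -> R) z : convex_pos h -> h 1 = 0 -> fdiv_fin h p q = z%:E ->
    exists phi : R -> R, [/\ continuous phi, phi 0 = 0, phi 1 = z &
      forall s, 0 <= s <= 1 -> fdiv_fin h (r s) q = (phi s)%:E].
  move=> hc h1 /(fdiv_fin_fine p0 q0)[a aE ->].
  have /choice[phi phiP] i := perspective_path hc h1 (p0 i) (q0 i) (aE i).
  exists (fun s => \sum_i phi i s); split.
  - move=> s; have [c0 _ _] := phiP ord0; have [c1 _ _] := phiP (lift ord0 ord0).
    rewrite (_ : (fun _ => _) = (fun s => phi ord0 s + phi (lift ord0 ord0) s)).
      by apply: continuousD; [exact: c0|exact: c1].
    by apply/funext => u; rewrite big_ord_recl big_ord1.
  - rewrite big1// => i _; have [_ _ /(_ 0)] := phiP i.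
    rewrite subr0 mul0r addr0 mul1r perspective_diag// lexx ler01 => /(_ erefl).
    by case=> <-.
  - by apply: eq_bigr => i _; have [] := phiP i.
  - move=> s s01; apply/fdiv_fin_fine; [exact: r0|exact: q0|].
    by exists (fun i => phi i s) => // i; have [_ _] := phiP i; exact.
have [phi [cphi phi0 phi1 phiE]] := P f x fc f1 xE.
have [psi [cpsi psi0 psi1 psiE]] := P g y gc g1 yE.
exists phi, psi; split=> // s s01.
exists (r s), q; split; [|split; [by []|by split; [exact: phiE|exact: psiE]]].
split; first exact: r0.
by rewrite big_split -!mulr_sumr /= ps qs; ring.
Qed.

Theorem theorem2 (R : realType) (f g : R -> R) :
  convex_pos f -> convex_pos g -> f 1 = 0 -> g 1 = 0 ->
  forall x y : R, achievable f g x y ->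
    (exists (lam x1 y1 x2 y2 : R),
        0 <= lam <= 1 /\
        achievable f g x1 y1 /\ achievable_fin f g 2 x1 y1 /\
        achievable f g x2 y2 /\ achievable_fin f g 2 x2 y2 /\
        x = lam * x1 + (1 - lam) * x2 /\ y = lam * y1 + (1 - lam) * y2)
    /\ achievable_fin f g 4 x y.
Proof.
move=> fc gc f1 g1 x y [d [T [mu [p [q [pd [qd [xE yE]]]]]]]].
have [Ffin F_int] := fdiv_has_integral fc pd qd xE.
have [Gfin G_int] := fdiv_has_integral gc pd qd yE.
have [mp [p0 p1]] := pd; have [mq [q0 q1]] := qd.
have p_int : has_integral mu p 1.
  by split=> //; apply: integral_fin_integrable; [exact/measurable_EFinP|rewrite p1].
have q_int : has_integral mu q 1.
  by split=> //; apply: integral_fin_integrable; [exact/measurable_EFinP|rewrite q1].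
(* Pairs are drawn only from points where both integrands are finite, so that the two-point
   divergences are finite too. *)
pose A := [set s | perspective f (p s) (q s) \is a fin_num /\
                   perspective g (p s) (q s) \is a fin_num].
have A_ae : {ae mu, forall s, A s} by apply: filterS2 Ffin Gfin.
have S00 : achievable_fin f g 2 0 0 by exact: achievable_fin_diag.
have [||x1 [y1 [x2 [y2 [a [b [S1 S2 [a0 b0 ab] -> ->]]]]]]] :=
  @barycenter_triangle _ _ _ mu p q _ _ x y A (achievable_fin f g 2)
    p_int q_int F_int G_int A_ae p0 q0 _ S00.
- move=> s _ /eqP; rewrite subr_eq0 => /eqP ->.
  by rewrite !perspective_diag.
- move=> i Ai; apply: (achievable_pair p0 q0 _ _ Ai).
    by move=> s [? _]; rewrite fineK.
  by move=> s [_ ?]; rewrite fineK.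
have [|lam [u1 [v1 [u2 [v2 [lam01 Su Sv -> ->]]]]]] :=
  triangle_segment S00 _ S1 S2 a0 b0 ab.
  by move=> *; exact: achievable_fin_path.
split; last exact: (achievable_fin_add lam01 Su Sv).
exists lam, u1, v1, u2, v2.
by do !split=> //; exact: achievable_fin2_achievable.
Qed.
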